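(* Let $A_q$ be a quantum cluster algebra with quantum seed $(\tilde X,\tilde B,\Lambda)$, let $k\in[1,n]$, and let $\{-,-\}$ be a nontrivial (i.e. not identically zero) Poisson structure on $A_q$. Suppose that both $\tilde X$ and $\mu_k(\tilde X)$ are log-canonical with respect to $\{-,-\}$, with Poisson matrices $\Omega=(\omega_{ij})_{m\times m}$ and $\Omega'=(\omega'_{ij})_{m\times m}$ respectively. Write $\delta_{ij}$ for the Kronecker delta. Then: (1) for every $j\in[1,m]$ with $j\neq k$, $$\sum_{t:\,b_{tk}>0}\Big(\omega_{tj}q^{\frac12\lambda_{jt}}\sum_{h=1}^{[b_{tk}]_+}q^{\sum_{i=t}^{m}([b_{ik}]_+-\delta_{ik})\lambda_{ji}-h\lambda_{jt}}\Big)-\omega_{kj}q^{\frac12\lambda_{kj}+\sum_{i=k+1}^{m}\lambda_{ji}[b_{ik}]_+}$$ $$=\sum_{t:\,b_{tk}<0}\Big(\omega_{tj}q^{\frac12\lambda_{jt}}\sum_{h=1}^{[-b_{tk}]_+}q^{\sum_{i=t}^{m}([-b_{ik}]_+-\delta_{ik})\lambda_{ji}-h\lambda_{jt}}\Big)-\omega_{kj}q^{\frac12\lambda_{kj}+\sum_{i=k+1}^{m}\lambda_{ji}[-b_{ik}]_+};$$ (2) denoting by $H_j$ the common value of the two sides of the equation in (1), the matrix $\Omega'$ is given by $$\omega'_{ij}=\begin{cases} q^{\frac12\left(\lambda_{jk}-\sum_{t=1}^{m}[b_{tk}]_+\lambda_{jt}\right)}H_j & \text{if } i=k\neq j,\\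 -\omega'_{ki} & \text{if } j=k\neq i,\\ \omega_{ij} & \text{otherwise.}\end{cases}$$
   Context: Notation: $[1,m]=\{1,\dots,m\}$; $[a]_+=\max\{a,0\}$, applied componentwise to vectors. Fix $n\le m$. Quantum cluster algebras. $\tilde B=(b_{ij})$ is an $m\times n$ integer matrix whose top $n\times n$ part $B$ is skew-symmetrizable: there is a positive diagonal matrix $D$ (a skew-symmetrizer) with $DB$ skew-symmetric. $\Lambda=(\lambda_{ij})$ is a skew-symmetric $m\times m$ integer matrix such that $(\tilde B,\Lambda)$ is a compatible pair: $\tilde B^\top\Lambda=(D\ \ O)$. Let $q$ be a formal variable. The quantum torus is the $\mathbb Z[q^{\pm 1/2}]$-algebra with basis $X^e$ ($e\in\mathbb Z^m$) and product $X^eX^f=q^{\frac12 e^\top\Lambda f}X^{e+f}$; $\mathscr F_q$ is its skew-field of fractions; $X_i=X^{e_i}$ with $e_i$ the standard basis. A quantum seed is $(\tilde X,\tilde B,\Lambda)$ with extended cluster $\tilde X=(X_1,\dots,X_m)$; $X_1,\dots,X_n$ are cluster variables and $X_{n+1},\dots,X_m$ are frozen. For $k\in[1,n]$ the mutation $\mu_k$ replaces $X_k$ by $X_k'=X^{-e_k+[b_k]_+}+X^{-e_k+[-b_k]_+}$ ($b_k$ the $k$-th column of $\tilde B$), replaces $\tilde B$ by $\tilde B'$ with $b'_{ij}=-b_{ij}$ if $i=k$ or $j=k$ and $b'_{ij}=b_{ij}+\mathrm{sgn}(b_{ik})[b_{ik}b_{kj}]_+$ otherwise, and replaces $\Lambda$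 by the skew-symmetric $\Lambda'$ with $\lambda'_{kj}=-\lambda_{kj}+\sum_{l=1}^m[b_{lk}]_+\lambda_{lj}$ for $j\ne k$ and $\lambda'_{ij}=\lambda_{ij}$ for $i,j\neq k$. The result is again a quantum seed, whose normalized monomials $X'^e$ satisfy the same relation with $\Lambda'$. $A_q$ is the $\mathbb Z[q^{\pm1/2}][X_{n+1}^{\pm1},\dots,X_m^{\pm1}]$-subalgebra of $\mathscr F_q$ generated by all cluster variables of all seeds obtained by iterated mutation. Poisson structures. A Poisson structure on an associative algebra over $k=\mathbb Z[q^{\pm1/2}]$ is a $k$-bilinear Lie bracket with $\{a,bc\}=\{a,b\}c+b\{a,c\}$ (the algebra need not be commutative); it is extended to fractions by the Leibniz rule. An extended cluster $\tilde X=(X_1,\dots,X_m)$ is log-canonical with respect to $\{-,-\}$ if $\{X_i,X_j\}=\omega_{ij}X^{e_i+e_j}$ with $\omega_{ij}\in\mathbb Z[q^{\pm1/2}]$ for all $i,j\in[1,m]$; then $\Omega=(\omega_{ij})$ is its Poisson matrix. *)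

(* Defs.v *)
From HB Require Import structures.
From mathcomp Require Import all_boot all_order all_algebra.
From mathcomp Require Import finmap.
From mathcomp Require Import boolp.
From mathcomp.multinomials Require Import monalg.

Set Implicit Arguments.
Unset Strict Implicit.
Unset Printing Implicit Defensive.

Import Order.TTheory GRing.Theory Num.Theory.
Local Open Scope fset_scope.
Local Open Scope ring_scope.

(* Twisted group algebras: the free R-module on a group G with
   << a >> * << b >> = chi a b *: << a + b >> for a 2-cocycle chi. *)

Record cocycle (R : comNzRingType) (G : zmodType) := Cocycle {
  cocycle_fun :> G -> G -> R;
  cocycle0l : forall a, cocycle_fun 0 a = 1;
  cocycle0r : forall a, cocycle_fun a 0 = 1;
  cocycleA : forall a b c,
    cocycle_fun a b * cocycle_fun (a + b) c =
    cocycle_fun b c * cocycle_fun a (b + c) }.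

Definition twisted (R : comNzRingType) (G : zmodType) (chi : cocycle R G) : Type :=
  {malg R[G]}.

HB.instance Definition _ R G chi := GRing.Lmodule.on (@twisted R G chi).

Section TwistedRing.
Context (R : comNzRingType) (G : zmodType) (chi : cocycle R G).
Implicit Types (g : {malg R[G]}) (a b c : G).

Definition twmul g1 g2 : {malg R[G]} :=
  \sum_(a <- msupp g1) \sum_(b <- msupp g2)
    << g1@_a * g2@_b * chi a b *g a + b >>.

Lemma twmulw (d1 d2 : {fset G}) g1 g2 :
  msupp g1 `<=` d1 -> msupp g2 `<=` d2 ->
  twmul g1 g2 =
  \sum_(a <- d1) \sum_(b <- d2) << g1@_a * g2@_b * chi a b *g a + b >>.
Proof.
move=> le1 le2; rewrite /twmul (big_fset_incl _ le1) /=.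
  apply/eq_bigr => a _; apply/big_fset_incl => // b _ /mcoeff_outdom ->.
  by rewrite mulr0 mul0r monalgU0.
move=> a _ /mcoeff_outdom g1a.
by rewrite big1 // => b _; rewrite g1a !mul0r monalgU0.
Qed.

Lemma twmulUU x y a b :
  twmul << x *g a >> << y *g b >> = << x * y * chi a b *g a + b >>.
Proof. by rewrite (twmulw msuppU_le msuppU_le) !big_seq_fset1 !mcoeffUU. Qed.

Lemma twmulDl : left_distributive twmul +%R.
Proof.
move=> g1 g2 g.
rewrite (twmulw (msuppD_le g1 g2) (fsubset_refl (msupp g))).
rewrite (twmulw (fsubsetUl _ (msupp g2)) (fsubset_refl (msupp g))).
rewrite (twmulw (fsubsetUr (msupp g1) _) (fsubset_refl (msupp g))).
rewrite -big_split /=; apply/eq_bigr => a _.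
rewrite -big_split /=; apply/eq_bigr => b _.
by rewrite mcoeffD !mulrDl monalgUD.
Qed.

Lemma twmulDr : right_distributive twmul +%R.
Proof.
move=> g g1 g2.
rewrite (twmulw (fsubset_refl (msupp g)) (msuppD_le g1 g2)).
rewrite (twmulw (fsubset_refl (msupp g)) (fsubsetUl _ (msupp g2))).
rewrite (twmulw (fsubset_refl (msupp g)) (fsubsetUr (msupp g1) _)).
rewrite -big_split /=; apply/eq_bigr => a _.
rewrite -big_split /=; apply/eq_bigr => b _.
by rewrite mcoeffD mulrDr mulrDl monalgUD.
Qed.

Lemma twmul0g : left_zero 0 twmul.
Proof. by move=> g; rewrite /twmul msupp0 big_seq_fset0. Qed.

Lemma twmulg0 : right_zero 0 twmul.
Proof.
by move=> g; rewrite /twmul big1 // => a _; rewrite msupp0 big_seq_fset0.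
Qed.

Lemma twmul_suml (I : Type) (r : seq I) (F : I -> {malg R[G]}) g :
  twmul (\sum_(i <- r) F i) g = \sum_(i <- r) twmul (F i) g.
Proof.
exact: (big_morph (twmul^~ g) (fun _ _ => twmulDl _ _ _) (twmul0g _)).
Qed.

Lemma twmul_sumr (I : Type) (r : seq I) (F : I -> {malg R[G]}) g :
  twmul g (\sum_(i <- r) F i) = \sum_(i <- r) twmul g (F i).
Proof.
exact: (big_morph (twmul g) (fun _ _ => twmulDr _ _ _) (twmulg0 _)).
Qed.

Lemma twmulA : associative twmul.
Proof.
move=> g1 g2 g3; rewrite (monalgE g1) !twmul_suml; apply/eq_bigr => a _.
rewrite (monalgE g2) twmul_suml !twmul_sumr twmul_suml; apply/eq_bigr => b _.
rewrite (monalgE g3) !twmul_sumr; apply/eq_bigr => c _.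
rewrite !twmulUU addrA; congr (<< _ *g _ >>).
by rewrite -!mulrA; do 2!congr (_ * _); rewrite [RHS]mulrCA cocycleA.
Qed.

Lemma twmul1g : left_id << 1 *g 0 >> twmul.
Proof.
move=> g; rewrite [in LHS](monalgE g) twmul_sumr [RHS]monalgE.
by apply/eq_bigr => a _; rewrite twmulUU mul1r cocycle0l mulr1 add0r.
Qed.

Lemma twmulg1 : right_id << 1 *g 0 >> twmul.
Proof.
move=> g; rewrite [in LHS](monalgE g) twmul_suml [RHS]monalgE.
by apply/eq_bigr => a _; rewrite twmulUU mulr1 cocycle0r mulr1 addr0.
Qed.

Lemma tw1_neq0 : << 1 *g 0 >> != 0 :> {malg R[G]}.
Proof. by rewrite monalgU_eq0 oner_eq0. Qed.

HB.instance Definition _ := GRing.Zmodule_isNzRing.Build (twisted chi)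
  twmulA twmul1g twmulg1 twmulDl twmulDr tw1_neq0.

Lemma twistedE (f g : twisted chi) : f * g = twmul f g.
Proof. by []. Qed.

Lemma twscaleU x y a : x *: << y *g a >> = << x * y *g a >> :> {malg R[G]}.
Proof. by apply/malgP => b; rewrite mcoeffZ !mcoeffU mulrnAr. Qed.

Lemma twmulZl x g1 g2 : x *: twmul g1 g2 = twmul (x *: g1) g2.
Proof.
rewrite (monalgE g1) (monalgE g2) [in RHS]scaler_sumr !twmul_suml scaler_sumr.
apply/eq_bigr => a _; rewrite !twmul_sumr scaler_sumr; apply/eq_bigr => b _.
by rewrite twmulUU !twscaleU twmulUU !mulrA.
Qed.

Lemma twmulZr x g1 g2 : x *: twmul g1 g2 = twmul g1 (x *: g2).
Proof.
rewrite (monalgE g1) (monalgE g2) [in RHS]scaler_sumr !twmul_suml scaler_sumr.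
apply/eq_bigr => a _; rewrite !twmul_sumr scaler_sumr; apply/eq_bigr => b _.
by rewrite twmulUU !twscaleU twmulUU !mulrA [x * _]mulrC.
Qed.

Lemma twscaleAl x (f g : twisted chi) : x *: (f * g) = (x *: f) * g.
Proof. exact: twmulZl. Qed.

Lemma twscaleAr x (f g : twisted chi) : x *: (f * g) = f * (x *: g).
Proof. exact: twmulZr. Qed.

HB.instance Definition _ :=
  GRing.Lmodule_isLalgebra.Build R (twisted chi) twscaleAl.
HB.instance Definition _ :=
  GRing.Lalgebra_isAlgebra.Build R (twisted chi) twscaleAr.

End TwistedRing.

(* Z[q^(1/2), q^(-1/2)] is the integral group ring of the additive group Z,
   the basis element << n >> being q^(n/2). *)

Definition laurent_cocycle : cocycle int int.
Proof. by refine (@Cocycle int int (fun _ _ => 1) _ _ _). Defined.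

Definition laurent : Type := twisted laurent_cocycle.
HB.instance Definition _ := GRing.NzRing.on laurent.

Lemma laurent_mulrC : commutative (@GRing.mul laurent).
Proof.
move=> f g; rewrite !twistedE [LHS]/twmul exchange_big; apply/eq_bigr => a _.
by apply/eq_bigr => b _; rewrite [X in X * _]mulrC [X in << _ *g X >>]addrC.
Qed.

HB.instance Definition _ :=
  GRing.PzRing_hasCommutativeMul.Build laurent laurent_mulrC.

(* qhalf a is q^(a/2), whereas qpow a is q^a. *)
Definition qhalf (a : int) : laurent := << 1 *g a >> : {malg int[int]}.
Definition qpow (a : int) : laurent := qhalf (2 * a).

Lemma qhalf0 : qhalf 0 = 1. Proof. by []. Qed.

Lemma qhalfD a b : qhalf (a + b) = qhalf a * qhalf b.
Proof. by rewrite [RHS]twistedE twmulUU !mulr1. Qed.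

Section QuantumTorus.
Context (m : nat) (Lam : 'M[int]_m).

Definition lam_form (e f : 'cV[int]_m) : int := (e^T *m Lam *m f) 0 0.

Lemma lam_formDl e e' f : lam_form (e + e') f = lam_form e f + lam_form e' f.
Proof. by rewrite /lam_form linearD /= !mulmxDl mxE. Qed.

Lemma lam_formDr e f f' : lam_form e (f + f') = lam_form e f + lam_form e f'.
Proof. by rewrite /lam_form mulmxDr mxE. Qed.

Lemma lam_form0l f : lam_form 0 f = 0.
Proof. by rewrite /lam_form trmx0 !mul0mx mxE. Qed.

Lemma lam_form0r e : lam_form e 0 = 0.
Proof. by rewrite /lam_form mulmx0 mxE. Qed.

Definition torus_cocycle : cocycle laurent 'cV[int]_m.
Proof.
refine (@Cocycle _ _ (fun e f => qhalf (lam_form e f)) _ _ _) => [f|e|e f g].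
- by rewrite lam_form0l.
- by rewrite lam_form0r.
- rewrite -!qhalfD lam_formDl lam_formDr; congr qhalf.
  by rewrite addrA [RHS]addrC addrAC.
Defined.

Definition qtorus : Type := twisted torus_cocycle.
HB.instance Definition _ := GRing.Algebra.on qtorus.

Definition torus_mon (e : 'cV[int]_m) : qtorus :=
  << 1 *g e >> : {malg laurent['cV[int]_m]}.

Lemma torus_monM e f :
  torus_mon e * torus_mon f = qhalf (lam_form e f) *: torus_mon (e + f).
Proof. by rewrite [LHS]twistedE twmulUU !mul1r [RHS]twscaleU mulr1. Qed.

End QuantumTorus.

(* F, with the embedding iota, is the skew-field of (right) fractions of T. *)
Definition is_skew_fraction_field (T : nzRingType) (F : unitRingType)
    (iota : T -> F) : Prop :=
  [/\ injective iota,
      forall x : F, x != 0 -> x \is a GRing.unit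
    & forall x : F, exists a b : T, b != 0 /\ x = iota a / iota b].

Definition posp (a : int) : int := Num.max a 0.

Section Seeds.
Context (m n : nat) (le_nm : (n <= m)%N).

(* For a m x n matrix B, the matrix D = diag_mx d is a skew-symmetrizer of the
   top square part of B, and B^T Lam = (D O). *)
Definition compatible_pair (B : 'M[int]_(m, n)) (Lam : 'M[int]_m)
    (d : 'rV[int]_n) : Prop :=
  let topB : 'M[int]_n := rowsub (widen_ord le_nm) B in
  [/\ forall i, 0 < d 0 i,
      (diag_mx d *m topB)^T = - (diag_mx d *m topB),
      Lam^T = - Lam
    & B^T *m Lam = \matrix_(i, j) (d 0 i *+ (i == j :> nat))].

Context (F : unitAlgType laurent).

Record qseed := QSeed {
  cluster : 'I_m -> F;
  exmx : 'M[int]_(m, n);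
  qform : 'M[int]_m }.

Definition basis_vec (i : 'I_m) : 'cV[int]_m := delta_mx i 0.

(* The normalized monomial X^e of a seed. The relation
   X^e X^f = q^(e^T Lam f / 2) X^(e+f) forces
   X^e = q^(- sum_(i < j) lam_ij e_i e_j / 2) X_1^(e_1) ... X_m^(e_m). *)
Definition qmon (S : qseed) (e : 'cV[int]_m) : F :=
  qhalf (- \sum_(i < m) \sum_(j < m | (i < j)%N) qform S i j * e i 0 * e j 0)
    *: \prod_(i < m) cluster S i ^ e i 0.

Section Mutation.
Context (k : 'I_n) (S : qseed).
Let k' : 'I_m := widen_ord le_nm k.
Let B := exmx S.
Let Lam := qform S.

Definition mut_cluster (i : 'I_m) : F :=
  if i == k' then
    qmon S (- basis_vec k' + map_mx posp (col k B))
    + qmon S (- basis_vec k' + map_mx posp (- col k B))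
  else cluster S i.

Definition mut_exmx : 'M[int]_(m, n) := \matrix_(i, j)
  if (i == k') || (j == k) then - B i j
  else B i j + Num.sg (B i k) * posp (B i k * B k' j).

Definition mut_row (j : 'I_m) : int :=
  - Lam k' j + \sum_(l < m) posp (B l k) * Lam l j.

Definition mut_qform : 'M[int]_m := \matrix_(i, j)
  if i == k' then (if j == k' then 0 else mut_row j)
  else if j == k' then - mut_row i
  else Lam i j.

Definition mutation : qseed := QSeed mut_cluster mut_exmx mut_qform.
End Mutation.

Inductive mutation_equivalent (S : qseed) : qseed -> Prop :=
| mutation_refl : mutation_equivalent S S
| mutation_step S' k :
    mutation_equivalent S S' -> mutation_equivalent S (mutation k S').

Section ClusterAlgebra.
Context (S0 : qseed).

(* The subalgebra of F generated by the cluster variables of the seeds mutation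
   equivalent to S0, the frozen variables and the inverses of the latter. *)
Inductive in_cluster_algebra : F -> Prop :=
| ica_cluster_var S (i : 'I_n) : mutation_equivalent S0 S ->
    in_cluster_algebra (cluster S (widen_ord le_nm i))
| ica_frozen (i : 'I_m) : (n <= i)%N -> in_cluster_algebra (cluster S0 i)
| ica_frozenV (i : 'I_m) : (n <= i)%N -> in_cluster_algebra (cluster S0 i)^-1
| ica_one : in_cluster_algebra 1
| ica_linear c x y : in_cluster_algebra x -> in_cluster_algebra y ->
    in_cluster_algebra (c *: x + y)
| ica_mul x y : in_cluster_algebra x -> in_cluster_algebra y ->
    in_cluster_algebra (x * y).

Definition cluster_algebra_pred : {pred F} := fun x => `[< in_cluster_algebra x >].

Lemma cluster_algebra_closed : subalg_closed cluster_algebra_pred.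
Proof.
split=> [|c x y|x y]; rewrite !unfold_in.
- exact/asboolP/ica_one.
- by move=> /asboolP Hx /asboolP Hy; apply/asboolP/ica_linear.
- by move=> /asboolP Hx /asboolP Hy; apply/asboolP/ica_mul.
Qed.

HB.instance Definition _ := GRing.isSubalgClosed.Build laurent F
  cluster_algebra_pred
  (GRing.subalg_closed_semi cluster_algebra_closed).

Definition cluster_algebra : Type := {x : F | x \in cluster_algebra_pred}.

HB.instance Definition _ := SubChoice.on cluster_algebra.
HB.instance Definition _ := [SubChoice_isSubAlgebra of cluster_algebra by <:].

Lemma cluster_in_algebra S : mutation_equivalent S0 S ->
  forall i, cluster S i \in cluster_algebra_pred.
Proof.
move=> eqS i; apply/asboolP; case: (ltnP i n) => [lt_in|le_ni].
  have ->: i = widen_ord le_nm (Ordinal lt_in) by apply: val_inj.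
  exact: ica_cluster_var.
suff ->: cluster S i = cluster S0 i by apply: ica_frozen.
elim: eqS => // S' k _ <-; rewrite /= /mut_cluster ifN //.
by apply: contraTneq le_ni => ->; rewrite -ltnNge /=.
Qed.

Definition cluster_elt S (eqS : mutation_equivalent S0 S) (i : 'I_m)
    : cluster_algebra :=
  Sub (cluster S i) (cluster_in_algebra eqS i).

Definition log_canonical S (eqS : mutation_equivalent S0 S)
    (br : cluster_algebra -> cluster_algebra -> cluster_algebra)
    (Om : 'M[laurent]_m) : Prop :=
  forall i j : 'I_m,
    val (br (cluster_elt eqS i) (cluster_elt eqS j))
    = Om i j *: qmon S (basis_vec i + basis_vec j).

End ClusterAlgebra.

Definition initial_seed (B : 'M[int]_(m, n)) (Lam : 'M[int]_m)
    (iota : qtorus Lam -> F) : qseed :=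
  QSeed (fun i => iota (torus_mon Lam (basis_vec i))) B Lam.

End Seeds.

Record is_poisson (R : nzRingType) (A : algType R) (br : A -> A -> A) : Prop := {
  poisson_linearl : forall c x y z, br (c *: x + y) z = c *: br x z + br y z;
  poisson_linearr : forall c x y z, br z (c *: x + y) = c *: br z x + br z y;
  poisson_alt : forall x, br x x = 0;
  poisson_jacobi : forall x y z,
    br x (br y z) + br y (br z x) + br z (br x y) = 0;
  poisson_leibniz : forall a b c, br a (b * c) = br a b * c + b * br a c }.

(* The left-hand side of the exchange identity is the case where b is the k-th
   column b_k of the exchange matrix, and the right-hand side is b = - b_k. *)
Definition exchange_side (m : nat) (b : 'cV[int]_m) (Lam : 'M[int]_m)
    (Om : 'M[laurent]_m) (k j : 'I_m) : laurent :=
  \sum_(t < m | 0 < b t 0)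
     (Om t j * qhalf (Lam j t) *
      \sum_(1 <= h < (absz (posp (b t 0))).+1)
         qpow (\sum_(i < m | (t <= i)%N)
                  (posp (b i 0) - (i == k)%:Z) * Lam j i
               - h%:Z * Lam j t))
  - Om k j * (qhalf (Lam k j)
              * qpow (\sum_(i < m | (k < i)%N) Lam j i * posp (b i 0))).

(* Main.v *)
(* For fixed j, log-canonicity gives {X^e, X_j} = c(e) X^e X_j with scalars c(e)
   such that c(e + f) = c(e) q^(Lam_j f) + c(f); expanding an ordered product
   turns c(-e_k + [b_k]_+) and c(-e_k + [-b_k]_+) into the two sides of the
   exchange identity. Compatibility makes both monomials of X_k' commute with X_j
   up to the same power of q, so log-canonicity of mu_k(X) says that {X_k', X_j}
   is a scalar multiple of X_k' X_j;
   comparing the coefficients of the two (distinct) monomials gives the identity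
   and the value of omega'_kj. *)

Require Import Defs.
From HB Require Import structures.
From mathcomp Require Import all_boot all_order all_algebra.
From mathcomp Require Import monalg.
From mathcomp Require Import ring zify.
Import GRing.Theory Num.Theory.
Local Open Scope ring_scope.
Set Implicit Arguments.
Unset Strict Implicit.
Unset Printing Implicit Defensive.

(** Ordered products are treated by induction on the increasing list of indices: the head precedes
    every index of the tail, so a condition [t < i] is decided at each step. *)
Lemma index_enum_ord_sorted m :
  sorted (fun i j : 'I_m => i < j)%N (index_enum 'I_m).
Proof.
have -> : index_enum 'I_m = enum 'I_m by rewrite enumT [index_enum _]unlock.
by rewrite -(sorted_map (f := val) (e':=ltn)) val_enum_ord iota_ltn_sorted.
Qed.

Lemma ltn_ord_trans m : transitive (fun i j : 'I_m => i < j)%N.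
Proof. by move=> j i l; apply: ltn_trans. Qed.

(** * Logarithmic derivatives and q-commutation *)

Section Poisson.
Context (R : comNzRingType) (A : algType R) (br : A -> A -> A).
Context (poisson_br : is_poisson br).

Lemma poisson_anti x y : br x y = - br y x.
Proof.
have linl := poisson_linearl poisson_br.
have linr := poisson_linearr poisson_br.
have := poisson_alt poisson_br (1 *: x + y).
rewrite linl !linr !(poisson_alt poisson_br) !scale1r add0r addr0.
by move/eqP; rewrite addr_eq0 => /eqP.
Qed.

Lemma poisson_Dl x y z : br (x + y) z = br x z + br y z.
Proof. by rewrite -[x]scale1r (poisson_linearl poisson_br) !scale1r. Qed.

Lemma poisson_Zl a x z : br (a *: x) z = a *: br x z.
Proof.
have br0 : br 0 z = 0 by apply: (addIr (br 0 z)); rewrite -poisson_Dl !add0r.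
by rewrite -[a *: x]addr0 (poisson_linearl poisson_br) br0 addr0.
Qed.

Lemma poisson_leibnizl a b z : br (a * b) z = br a z * b + a * br b z.
Proof.
rewrite poisson_anti (poisson_leibniz poisson_br).
by rewrite (poisson_anti z a) (poisson_anti z b) mulNr mulrN -opprD opprK.
Qed.

Context (z : A).

Definition qcomm (b : A) (p : R) := z * b = p *: (b * z).
(** A relation rather than a function: in a general algebra the scalar may fail to exist or to be
    unique. *)
Definition log_derivative (a : A) (c : R) := br a z = c *: (a * z).

Lemma qcomm1 : qcomm 1 1.
Proof. by rewrite /qcomm mulr1 mul1r scale1r. Qed.

Lemma qcommM a b p r : qcomm a p -> qcomm b r -> qcomm (a * b) (p * r).
Proof.
rewrite /qcomm => za zb.
by rewrite mulrA za -scalerAl -[a * z * b]mulrA zb -scalerAr scalerA mulrA.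
Qed.

Lemma qcommX a p n : qcomm a p -> qcomm (a ^+ n) (p ^+ n).
Proof.
move=> za; elim: n => [|n IHn]; first exact: qcomm1.
by rewrite !exprS; apply: qcommM.
Qed.

Lemma qcomm_prod (I : Type) (r : seq I) (x : I -> A) (p : I -> R) :
  (forall i, qcomm (x i) (p i)) ->
  qcomm (\prod_(i <- r) x i) (\prod_(i <- r) p i).
Proof.
move=> zx; elim: r => [|i r IHr]; first by rewrite !big_nil; apply: qcomm1.
by rewrite !big_cons; apply: qcommM.
Qed.

Lemma log_derivative1 : log_derivative 1 0.
Proof.
rewrite /log_derivative scale0r; apply: (addIr (br 1 z)).
by rewrite add0r -{3}[1]mulr1 poisson_leibnizl mulr1 mul1r.
Qed.

(** In the Leibniz rule, the [z] produced by the bracket of [a] stands to the left of [b]. Moving it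
    past [b] multiplies [c], and only [c], by [p]. *)
Lemma log_derivativeM a b c d p : log_derivative a c -> log_derivative b d ->
  qcomm b p -> log_derivative (a * b) (c * p + d).
Proof.
rewrite /log_derivative /qcomm => da db zb.
rewrite poisson_leibnizl da db -scalerAl -[a * z * b]mulrA zb.
by rewrite -!scalerAr scalerA mulrA -scalerDl.
Qed.

Lemma log_derivativeZ s a c : log_derivative a c -> log_derivative (s *: a) c.
Proof.
rewrite /log_derivative => da.
by rewrite poisson_Zl da -scalerAl !scalerA mulrC.
Qed.

(** The [h]-th copy of [a] has [n - h] copies to its right, which [z] must pass. *)
Lemma log_derivativeX a c p n : log_derivative a c -> qcomm a p ->
  log_derivative (a ^+ n) (c * \sum_(1 <= h < n.+1) p ^+ (n - h)).
Proof.
move=> da za; elim: n => [|n IHn].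
  by rewrite big_geq // mulr0; apply: log_derivative1.
rewrite big_nat_recl //= subn1 mulrDr exprS.
exact: (log_derivativeM da IHn (qcommX n za)).
Qed.

Lemma log_derivative_prod m (x : 'I_m -> A) (c p : 'I_m -> R) :
  (forall t, log_derivative (x t) (c t)) -> (forall t, qcomm (x t) (p t)) ->
  log_derivative (\prod_t x t) (\sum_t c t * \prod_(i < m | (t < i)%N) p i).
Proof.
move=> dx zx.
elim: (index_enum _) (index_enum_ord_sorted m) => [|t r IHr] /= lt_r.
  by rewrite !big_nil; apply: log_derivative1.
have lt_t : all (fun i : 'I_m => t < i)%N r.
  exact: order_path_min (@ltn_ord_trans m) lt_r.
rewrite !big_cons ltnn.
have := log_derivativeM (dx t) (IHr (path_sorted lt_r)) (qcomm_prod r zx).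
congr (log_derivative _ (_ * _ + _)).
  by rewrite -(big_filter _ (fun i : 'I_m => t < i)%N) (all_filterP lt_t).
rewrite !big_seq; apply: eq_bigr => s r_s; congr (_ * _).
by rewrite big_cons ltnNge ltnW // (allP lt_t).
Qed.

End Poisson.

(** * Telescoping sums attached to ordered products *)

Section Exchange.
Context (R : comNzRingType) (m : nat) (k : 'I_m).

(** Each summand is the difference of two consecutive tail products [q t - q t.+1]. *)
Lemma sum_telescope_prod_lt (p : 'I_m -> R) :
  \sum_(t < m | (t < k)%N) (p t - 1) * \prod_(i < m | (t < i)%N) p i =
  \prod_i p i - \prod_(i < m | (k <= i)%N) p i.
Proof.
pose q j := \prod_(i < m | (j <= i)%N) p i.
have -> : \prod_i p i = q 0%N by apply: eq_bigl.
have := telescope_sumr (fun j => - q j) (leq0n k); rewrite opprK addrC => <-.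
rewrite big_mkord.
rewrite (big_ord_widen m (fun j => - q j.+1 - - q j) (ltnW (ltn_ord k))).
apply: eq_bigr => t _; rewrite opprK [RHS]addrC /q.
rewrite [X in _ = X - _](bigD1 t) //=.
rewrite mulrBl mul1r; congr (_ * _ - _).
by apply: eq_bigl => i; rewrite ltn_neqAle eq_sym andbC.
Qed.

(* Moving the inverse of the k-th factor (with q-commutation factor [v]) from
   its place in an ordered product to the front changes the coefficient of every
   earlier factor by [1 - v]; the hypothesis makes these changes telescope. *)
Lemma ordered_sum_move (a P : 'I_m -> R) (pk v : R) (ck : R) :
  v * pk = 1 -> (forall t, a t * (pk - 1) = ck * (P t - 1)) -> P k = 1 ->
  \sum_t a t * \prod_(i < m | (t < i)%N) P i * (if (t < k)%N then v else 1)
    - ck * v * \prod_(i < m | (k < i)%N) P i =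
  \sum_t a t * \prod_(i < m | (t < i)%N) P i - ck * v * \prod_i P i.
Proof.
move=> vp aP Pk; apply/eqP; rewrite -subr_eq0 opprD opprK addrACA -sumrB.
(* As [P k = 1], the tail product over [k <= i] equals the one over [k < i]. *)
have := sum_telescope_prod_lt P; rewrite [X in _ - X](bigD1 k) //= Pk mul1r.
rewrite [X in _ - X](eq_bigl (fun i : 'I_m => k < i)%N); last first.
  by move=> i; rewrite [RHS]ltn_neqAle eq_sym andbC.
move=> /(congr1 ( *%R (ck * v))); rewrite mulrBr mulr_sumr => telP.
rewrite (eq_bigr (fun t : 'I_m => if (t < k)%N then
   - (ck * v * ((P t - 1) * \prod_(i < m | (t < i)%N) P i)) else 0)); last first.
  move=> t _; case: ifP => _; last by rewrite mulr1 subrr.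
  set Q := \prod_(i < m | _) _.
  (* Writing [1] as [v * pk] turns [v - 1] into [- v * (pk - 1)], to which the hypothesis on [a]
     applies. *)
  have aQ : a t * Q = v * pk * (a t * Q) by rewrite vp mul1r.
  rewrite {2}aQ.
  have -> : ck * v * ((P t - 1) * Q) = v * (ck * (P t - 1)) * Q by ring.
  by rewrite -aP; ring.
by rewrite -big_mkcond sumrN telP; apply/eqP; ring.
Qed.

End Exchange.

(** * The skew form on exponent vectors *)

Section Form.
Context (m : nat) (Lam : 'M[int]_m) (skewLam : Lam^T = - Lam).
Implicit Types (e f : 'cV[int]_m) (i j : 'I_m).

Lemma skew_entry i j : Lam i j = - Lam j i.
Proof. by have /matrixP/(_ j i) := skewLam; rewrite !mxE. Qed.

Lemma lam_formC e f : lam_form Lam e f = - lam_form Lam f e.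
Proof.
rewrite /lam_form; have -> : e^T *m Lam *m f = (f^T *m Lam^T *m e)^T.
  by rewrite !trmx_mul !trmxK mulmxA.
by rewrite mxE skewLam mulmxN mulNmx mxE.
Qed.

Lemma lam_form_alt e : lam_form Lam e e = 0.
Proof. by have := lam_formC e e; lia. Qed.

Lemma lam_form_sumr (I : Type) (r : seq I) (E : I -> 'cV[int]_m) e :
  lam_form Lam e (\sum_(i <- r) E i) = \sum_(i <- r) lam_form Lam e (E i).
Proof.
by apply: (big_morph (lam_form Lam e)) => [x y|];
  rewrite (lam_formDr, lam_form0r).
Qed.

Lemma lam_formZZ a b e f :
  lam_form Lam (a *: e) (b *: f) = a * b * lam_form Lam e f.
Proof.
rewrite /lam_form [(a *: e)^T]linearZ /= -!scalemxAl -scalemxAr !mxE.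
by rewrite mulrA.
Qed.

Lemma lam_formNr e f : lam_form Lam e (- f) = - lam_form Lam e f.
Proof. by rewrite /lam_form mulmxN mxE. Qed.

Lemma lam_form_delta i j :
  lam_form Lam (basis_vec i) (basis_vec j) = Lam i j.
Proof.
by rewrite /lam_form /basis_vec trmx_delta -rowE -colE !mxE.
Qed.

Lemma col_basis_sum e : e = \sum_i e i 0 *: basis_vec i.
Proof.
apply/colP => j; rewrite summxE (bigD1 j) //= !mxE !eqxx mulr1.
by rewrite big1 ?addr0 // => i nij; rewrite !mxE eq_sym (negPf nij) mulr0.
Qed.

Lemma lam_form_basisl i e :
  lam_form Lam (basis_vec i) e = \sum_l Lam i l * e l 0.
Proof.
rewrite [in LHS](col_basis_sum e) lam_form_sumr; apply: eq_bigr => l _.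
by rewrite -[basis_vec i]scale1r lam_formZZ mul1r lam_form_delta mulrC.
Qed.

End Form.

Lemma pospE a : posp a = (absz (posp a))%:Z.
Proof. by rewrite /posp; lia. Qed.

Lemma pospN a : posp a = posp (- a) + a.
Proof. by rewrite /posp; lia. Qed.

Lemma map_pospN m (b : 'cV[int]_m) : map_mx posp b = map_mx posp (- b) + b.
Proof. by apply/matrixP => i l; rewrite !mxE -pospN. Qed.

(** The two exponents differ by [b], since [[b]_+ - [-b]_+ = b]. *)
Lemma exchange_exponents_neq m (k : 'I_m) (b : 'cV[int]_m) : b != 0 ->
  - basis_vec k + map_mx posp b != - basis_vec k + map_mx posp (- b).
Proof.
move=> b0; rewrite -subr_eq0 opprD addrACA subrr add0r.
by rewrite map_pospN addrC addKr.
Qed.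

Lemma sum_rev_geometric (R : comNzRingType) (p : R) n :
  (\sum_(1 <= h < n.+1) p ^+ (n - h)) * (p - 1) = p ^+ n - 1.
Proof.
elim: n => [|n IHn]; first by rewrite big_geq // mul0r subrr.
rewrite big_nat_recl //= subn1 mulrDl.
by rewrite (eq_bigr (fun h => p ^+ (n - h))) // IHn exprS; ring.
Qed.

(** * The exchange sum as a coefficient of an ordered product *)

Section Exponential.
Context (R : comNzRingType) (qh : int -> R).
Context (qh0 : qh 0 = 1) (qhD : {morph qh : a b / a + b >-> a * b}).
Context (m : nat) (Lam : 'M[int]_m) (skewLam : Lam^T = - Lam).

Lemma qhX a l : qh a ^+ l = qh (a * l%:Z).
Proof.
elim: l => [|l IHl]; first by rewrite mulr0 qh0.
by rewrite exprS IHl -qhD intS mulrDr mulr1.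
Qed.

(* [exchange_side] is the case [qh = qhalf]. An abstract exponential keeps
   unification from unfolding the construction of Laurent polynomials. *)
Definition exchange_sum (b : 'cV[int]_m) (Om : 'M[R]_m) (k j : 'I_m) : R :=
  \sum_(t < m | 0 < b t 0)
     (Om t j * qh (Lam j t) *
      \sum_(1 <= h < (absz (posp (b t 0))).+1)
         qh (2 * (\sum_(i < m | (t <= i)%N)
                  (posp (b i 0) - (i == k)%:Z) * Lam j i
               - h%:Z * Lam j t)))
  - Om k j * (qh (Lam k j)
              * qh (2 * \sum_(i < m | (k < i)%N) Lam j i * posp (b i 0))).

(** The term [- (i == k)] in the exponents of [exchange_sum] describes an ordered product with the
    inverse of the [k]-th variable at its own place. Moving this inverse to the front separates the
    contribution of the nonnegative exponents [n] from a multiple of [c k]. *)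
Lemma exchange_sumE (b : 'cV[int]_m) (Om : 'M[R]_m) (k j : 'I_m) :
  let c t := Om t j * qh (Lam j t) in
  let p t := qh (2 * Lam j t) in
  let n t := absz (posp (b t 0)) in
  b k 0 = 0 ->
  (forall t, c t * (p k - 1) = c k * (p t - 1)) ->
  exchange_sum b Om k j =
  \sum_t c t * (\sum_(1 <= h < (n t).+1) p t ^+ (n t - h)) *
     \prod_(i < m | (t < i)%N) p i ^+ n i
  - c k * qh (2 * (- Lam j k)) * \prod_i p i ^+ n i.
Proof.
move=> c p n bk0 cp; rewrite /exchange_sum; set qp := fun a => qh (2 * a).
have qpD : {morph qp : x y / x + y >-> x * y}.
  by move=> x y; rewrite /qp mulrDr qhD.
have qp0 : qp 0 = 1 by rewrite /qp mulr0.
have qpX i : p i ^+ n i = qp (Lam j i * posp (b i 0)).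
  by rewrite qhX -mulrA -pospE.
have qp_sum (P : pred 'I_m) (f : 'I_m -> int) :
    \prod_(i | P i) qp (f i) = qp (\sum_(i | P i) f i).
  by rewrite (big_morph qp qpD qp0).
have nk0 : n k = 0%N by rewrite /n bk0.
(* Here [a t] is [c t] times a geometric sum, [P t] is [p t ^+ n t], and [v] is the inverse of
   [p k]. Multiplying the geometric sum by [p t - 1] yields the hypothesis on [a]. *)
rewrite -(ordered_sum_move (k := k) (pk := p k)); first last.
- by rewrite nk0.
- by move=> t; rewrite mulrAC cp -mulrA [X in _ * X]mulrC sum_rev_geometric.
- by rewrite -qhD mulrN addNr.
congr (_ - _); last first.
  rewrite (eq_bigr _ (fun i _ => qpX i)).
  rewrite qp_sum -!mulrA; congr (_ * _); rewrite mulrA; congr (_ * _).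
  by rewrite -qhD (skew_entry skewLam k j); congr qh; ring.
rewrite [LHS]big_mkcond /=; apply: eq_bigr => t _; case: ifP => bt; last first.
  have -> : n t = 0%N by rewrite /n /posp; lia.
  by rewrite big_geq // mulr0 !mul0r.
have nkt : t != k by apply: contraTneq bt => ->; rewrite bk0.
rewrite -/(c t) -[RHS]mulrA -[RHS]mulrA; congr (_ * _).
rewrite mulr_suml big_nat [RHS]big_nat; apply: eq_bigr => h /andP[h1 hn].
rewrite (eq_bigr _ (fun i _ => qpX i)).
rewrite qp_sum.
have -> : (if (t < k)%N then qh (2 * - Lam j k) else 1) =
    qp (if (t < k)%N then - Lam j k else 0) by case: ifP.
(* The bound [h <= n t] makes the truncated subtraction agree with the integer one. *)
have -> : p t ^+ (n t - h) = qp ((posp (b t 0) - h%:Z) * Lam j t).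
  by rewrite pospE -/(n t) subzn ?ltnS // qhX /qp mulrC mulrCA.
rewrite -!qpD -/(qp _); congr qp.
rewrite (bigD1 t) //= (negPf nkt) subr0.
rewrite (eq_bigl (fun i : 'I_m => t < i)%N); last first.
  by move=> i; rewrite [RHS]ltn_neqAle eq_sym andbC.
(* The Kronecker delta is split off; it contributes exactly when [t < k], which is the factor
   [v]. *)
rewrite (eq_bigr (fun i : 'I_m =>
    Lam j i * posp (b i 0) + (if i == k then - Lam j k else 0))); last first.
  by move=> i _; case: eqVneq => [->|_] /=; ring.
rewrite big_split /= -big_mkcondr /=.
have -> : \sum_(i < m | (t < i)%N && (i == k)) - Lam j k =
    if (t < k)%N then - Lam j k else 0.
  case: ifP => tk; last first.
    by rewrite big1 // => i /andP[ti /eqP ik]; rewrite -ik ti in tk.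
  rewrite (eq_bigl (pred1 k)) ?big_pred1_eq // => i /=.
  by case: eqVneq => [->|_]; rewrite ?tk ?andbF.
by ring.
Qed.

(** * Normalized monomials: commutation, products and independence *)

Context (F : unitAlgType R) (mon : 'cV[int]_m -> F) (mon0 : mon 0 = 1).
Context (monM : forall e f,
  mon e * mon f = qh (lam_form Lam e f) *: mon (e + f)).
Context (mon_free : forall e f g (a b : R),
  a *: mon e = b *: mon f -> a *+ (e == g) = b *+ (f == g)).
Implicit Types (e f : 'cV[int]_m).

Lemma monVr e : mon e * mon (- e) = 1.
Proof.
rewrite monM subrr mon0 -[- e]scaleN1r -[e in lam_form _ e _]scale1r.
by rewrite lam_formZZ lam_form_alt // mulr0 qh0 scale1r.
Qed.

Lemma mon_unit e : mon e \is a GRing.unit.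
Proof.
by apply/unitrP; exists (mon (- e)); rewrite monVr -{2}[e]opprK monVr.
Qed.

Lemma mon_exprn e n : mon e ^+ n = mon (n%:Z *: e).
Proof.
elim: n => [|n IHn]; first by rewrite scale0r mon0.
rewrite exprS IHn monM -{1}[e]scale1r lam_formZZ lam_form_alt // mulr0.
by rewrite qh0 scale1r -{1}[e]scale1r -scalerDl intS.
Qed.

Lemma mon_exprz e z : mon e ^ z = mon (z *: e).
Proof.
case: z => n; first by rewrite -exprnP mon_exprn.
rewrite NegzE -exprnN mon_exprn scaleNr.
apply: (mulrI (mon_unit (n.+1%:Z *: e))).
by rewrite divrr ?mon_unit // monVr.
Qed.

Lemma mon_comm e f :
  mon e * mon f = qh (2 * lam_form Lam e f) *: (mon f * mon e).
Proof.
rewrite !monM scalerA [f + e]addrC -qhD (lam_formC skewLam f e).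
by congr (qh _ *: _); ring.
Qed.

Lemma mon_binomial_comm e f g : lam_form Lam e f = lam_form Lam e g ->
  mon e * (mon f + mon g) =
  qh (2 * lam_form Lam e f) *: ((mon f + mon g) * mon e).
Proof.
move=> efg; rewrite mulrDr [(_ + _) * mon e]mulrDl scalerDr.
by rewrite -mon_comm efg -mon_comm.
Qed.

(** Multiplying on the left by [mon (E t)] contributes its form with every later exponent, hence one
    factor for each pair [i < j]. *)
Lemma mon_prod (E : 'I_m -> 'cV[int]_m) :
  \prod_i mon (E i) =
  qh (\sum_(i < m) \sum_(j < m | (i < j)%N) lam_form Lam (E i) (E j))
    *: mon (\sum_i E i).
Proof.
elim: (index_enum _) (index_enum_ord_sorted m) => [|t r IHr] /= lt_r.
  by rewrite !big_nil mon0 qh0 scale1r.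
have lt_t : all (fun i : 'I_m => t < i)%N r.
  exact: order_path_min (@ltn_ord_trans m) lt_r.
rewrite !big_cons ltnn (IHr (path_sorted lt_r)) -scalerAr monM scalerA -qhD.
congr (qh _ *: _); rewrite addrC lam_form_sumr; congr (_ + _).
  rewrite -[in RHS](big_filter _ (fun i : 'I_m => t < i)%N).
  by rewrite (all_filterP lt_t).
rewrite !big_seq; apply: eq_bigr => s r_s.
by rewrite big_cons ltnNge ltnW // (allP lt_t).
Qed.

Lemma mon_indep e f (a b a' b' : R) : e != f ->
  a *: mon e + b *: mon f = a' *: mon e + b' *: mon f -> a = a' /\ b = b'.
Proof.
move=> nef /eqP; rewrite -subr_eq0 opprD addrACA -!scalerBl addr_eq0 -scaleNr.
(* A multiple of [mon e] equals a multiple of [mon f]; reading off the coefficients at [e] and at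
   [f] kills both scalars. *)
move=> /eqP eq_ab; have := (mon_free e eq_ab, mon_free f eq_ab).
rewrite !eqxx [f == e]eq_sym (negPf nef) !mulr1n !mulr0n.
by case=> /eqP + /esym/eqP; rewrite oppr_eq0 !subr_eq0 => /eqP-> /eqP->.
Qed.

Lemma mon_binomial_neq0 e f : e != f -> mon e + mon f != 0.
Proof.
move=> nef; apply/eqP => ef0.
have [] : (1 : R) = 0 /\ (1 : R) = 0.
  by apply: (mon_indep nef); rewrite !scale1r !scale0r addr0.
by move/eqP; rewrite oner_eq0.
Qed.

(** Dividing by [x] reduces to freeness of [1], which is [mon 0]. *)
Lemma scale_unit_inj (x : F) (a b : R) :
  x \is a GRing.unit -> a *: x = b *: x -> a = b.
Proof.
move=> Ux /(congr1 (fun y => y / x)); rewrite -!scalerAl divrr // -mon0.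
by move/(mon_free 0); rewrite eqxx.
Qed.

(** * Brackets of monomials with a cluster variable *)

Context (A : algType R) (v : {lrmorphism A -> F}) (inj_v : injective v).
Context (br : A -> A -> A) (poisson_br : is_poisson br) (Om : 'M[R]_m).
Context (x : 'I_m -> A) (vx : forall i, v (x i) = mon (basis_vec i)).
Context (logOm : forall i j,
  v (br (x i) (x j)) = Om i j *: mon (basis_vec i + basis_vec j)).

Lemma log_derivative_x j t :
  log_derivative br (x j) (x t) (Om t j * qh (Lam j t)).
Proof.
apply: inj_v; rewrite linearZ rmorphM /= logOm !vx.
rewrite monM lam_form_delta scalerA -mulrA.
by rewrite -qhD (skew_entry skewLam j t) addNr qh0 mulr1.
Qed.

Lemma qcomm_x j t : qcomm (x j) (x t) (qh (2 * Lam j t)).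
Proof.
apply: inj_v; rewrite linearZ !rmorphM /= !vx.
by rewrite mon_comm lam_form_delta.
Qed.

(* Both sides come from the bracket of [x s * x t], a multiple of [x t * x s]. *)
Lemma log_derivative_consistent j s t :
  Om t j * qh (Lam j t) * (qh (2 * Lam j s) - 1) =
  Om s j * qh (Lam j s) * (qh (2 * Lam j t) - 1).
Proof.
have dx := log_derivative_x j; have zx := qcomm_x j.
have dst := log_derivativeM poisson_br (dx s) (dx t) (zx t).
have dts := log_derivativeM poisson_br (dx t) (dx s) (zx s).
have := log_derivativeZ poisson_br (qh (2 * Lam s t)) dts.
rewrite -[_ *: _](qcomm_x s t) /log_derivative dst => /(congr1 v).
rewrite !linearZ => eq_val.
have Ux : v (x s * x t * x j) \is a GRing.unit.
  by rewrite !rmorphM /= !vx !unitrMl ?mon_unit.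
have eq_c := scale_unit_inj Ux eq_val.
rewrite !mulrBr !mulr1; apply/eqP; rewrite subr_eq addrAC eq_sym subr_eq.
by rewrite eq_c.
Qed.

Lemma positive_part_sum (b : 'cV[int]_m) :
  \sum_t (absz (posp (b t 0)))%:Z *: basis_vec t = map_mx posp b.
Proof.
rewrite [RHS]col_basis_sum; apply: eq_bigr => t _.
by rewrite -pospE mxE.
Qed.

(** Nonnegative exponents keep the ordered product inside [A], and the scalar that normalizes it
    does not affect the logarithmic derivative. *)
Lemma log_derivative_monomial (b : 'cV[int]_m) j :
  let n t := absz (posp (b t 0)) in
  exists2 y, v y = mon (map_mx posp b) & log_derivative br (x j) y
    (\sum_t Om t j * qh (Lam j t) *
       (\sum_(1 <= h < (n t).+1) qh (2 * Lam j t) ^+ (n t - h)) *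
       \prod_(i < m | (t < i)%N) qh (2 * Lam j i) ^+ n i).
Proof.
move=> n.
have dX t :=
  log_derivativeX poisson_br (n t) (log_derivative_x j t) (qcomm_x j t).
have zX t := qcommX (n t) (qcomm_x j t).
have := log_derivative_prod poisson_br dX zX.
set y := \prod_t _ => dy.
have := mon_prod (fun t => (n t)%:Z *: basis_vec t).
set s := \sum_(i < m) _; rewrite positive_part_sum => vy.
exists (qh (- s) *: y); last exact: (log_derivativeZ poisson_br).
rewrite linearZ rmorph_prod /=.
under eq_bigr do rewrite rmorphXn /= vx mon_exprn.
by rewrite vy scalerA -qhD addNr qh0 scale1r.
Qed.

Context (k : 'I_m) (b : 'cV[int]_m) (bk0 : b k 0 = 0) (b_neq0 : b != 0).
Let up := - basis_vec k + map_mx posp b.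
Let un := - basis_vec k + map_mx posp (- b).

(** The coefficient is the one [log_derivativeM] would give for [x k] times an element with
    coefficient [exchange_sum a Om k j]. Only the product is used, because [mon u] need not come
    from [A]. *)
Lemma exchange_sum_monomial (a : 'cV[int]_m) (j : 'I_m) :
  a k 0 = 0 ->
  let u := - basis_vec k + map_mx posp a in
  exists2 y, v y = mon (basis_vec k) * mon u &
    log_derivative br (x j) y
      (exchange_sum a Om k j
       + Om k j * qh (Lam j k) * qh (2 * lam_form Lam (basis_vec j) u)).
Proof.
move=> ak0 u; have [y vy dy] := log_derivative_monomial a j.
exists (qh (lam_form Lam (basis_vec k) u) *: y).
  by rewrite linearZ /= vy monM addNKr.
apply: (log_derivativeZ poisson_br); move: dy; congr log_derivative.
rewrite exchange_sumE //; last by move=> t; apply: log_derivative_consistent.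
(* The commutation factor of [mon u] is the product in the correction term of [exchange_sumE], so
   the two terms in [Om k j] cancel. *)
suff -> : qh (2 * lam_form Lam (basis_vec j) u) =
    qh (2 * - Lam j k) * \prod_i qh (2 * Lam j i) ^+ absz (posp (a i 0)).
  by rewrite mulrA subrK.
rewrite lam_formDr lam_formNr lam_form_delta mulrDr qhD; congr (_ * _).
rewrite lam_form_basisl mulr_sumr (big_morph qh qhD qh0).
by apply: eq_bigr => i _; rewrite mxE qhX -pospE mulrA.
Qed.

(** The bracket of [x k * x'] with [x j] is computed by the Leibniz rule and through the two
    monomials. As [b] is orthogonal to [basis_vec j], both monomials have the same commutation
    factor, so the terms in [Om k j] cancel; independence then separates the two coefficients. *)
Lemma exchange_sum_mutation (x' : A) (j : 'I_m) (om : R) :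
  v x' = mon up + mon un -> lam_form Lam (basis_vec j) b = 0 ->
  v (br x' (x j)) = om *: (v x' * mon (basis_vec j)) ->
  exchange_sum b Om k j = om /\ exchange_sum (- b) Om k j = om.
Proof.
move=> vx' jb brx'.
have bNk0 : (- b) k 0 = 0 by rewrite mxE bk0 oppr0.
have [yp vyp dyp] := exchange_sum_monomial j bk0.
have [yn vyn dyn] := exchange_sum_monomial j bNk0.
have unp : up != un := exchange_exponents_neq k b_neq0.
(* The inverse of [x k] need not lie in [A], so [x'] is reached through this
   identity between elements of [A]. *)
have xx' : x k * x' = yp + yn.
  by apply: inj_v; rewrite rmorphM rmorphD /= vx' vyp vyn vx mulrDr.
have pn : lam_form Lam (basis_vec j) up = lam_form Lam (basis_vec j) un.
  by rewrite /up /un !lam_formDr map_pospN lam_formDr jb addr0.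
have zup : mon (basis_vec j) * mon up =
    qh (2 * lam_form Lam (basis_vec j) up) *: (mon up * mon (basis_vec j)).
  exact: mon_comm.
have zun : mon (basis_vec j) * mon un =
    qh (2 * lam_form Lam (basis_vec j) up) *: (mon un * mon (basis_vec j)).
  by rewrite pn mon_comm.
have := congr1 v (congr1 (br^~ (x j)) xx').
rewrite poisson_Dl // poisson_leibnizl // dyp dyn log_derivative_x.
rewrite !(rmorphM, rmorphD) /= !linearZ /= !rmorphM /= vyp vyn vx brx' vx' !vx.
rewrite -/up -/un -pn; set p := qh (2 * _) in zup zun *.
move: (Om k j * qh (Lam j k)) (exchange_sum b _ _ _) => c L.
move: (exchange_sum (- b) _ _ _) => N; set E := mon (basis_vec j) in zup zun *.
(* Every term has [mon (basis_vec k)] as its left factor. *)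
rewrite -scalerAl -!mulrA !scalerAr -!mulrDr => /(mulrI (mon_unit _)).
rewrite -!scalerAr mulrDr mulrDl zup zun !scalerDl !scalerDr !scalerA.
rewrite [RHS]addrACA [RHS]addrC => /addrI; rewrite !scalerAl -!mulrDl.
by move/(mulIr (mon_unit _))/(mon_indep unp) => [<- <-].
Qed.

End Exponential.

(** Since [op] may be noncommutative, the order of the two factors matters: the filtered index list
    is increasing, hence equal to [[:: i; j]]. *)
Lemma big_ord_pair (T : Type) (idx : T) (op : Monoid.law idx) m (f : 'I_m -> T)
    (i j : 'I_m) :
  (i < j)%N -> (forall l, l != i -> l != j -> f l = idx) ->
  \big[op/idx]_l f l = op (f i) (f j).
Proof.
move=> lt_ij f1; transitivity (\big[op/idx]_(l | (l == i) || (l == j)) f l).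
  rewrite [RHS]big_mkcond; apply: eq_bigr => l _; case: ifPn => //.
  by rewrite negb_or => /andP[]; apply: f1.
rewrite -big_filter; set s := filter _ _.
suff -> : s = [:: i; j] by rewrite !big_cons big_nil Monoid.mulm1.
apply: (irr_sorted_eq (@ltn_ord_trans m)).
- by move=> l; rewrite /= ltnn.
- exact: sorted_filter (@ltn_ord_trans m) _ _ (index_enum_ord_sorted m).
- by rewrite /= lt_ij.
- by move=> l; rewrite mem_filter mem_index_enum andbT !inE.
Qed.

(** * Normalized monomials of a seed *)

Section Seeds.
Context (m n : nat) (le_nm : (n <= m)%N) (F : unitAlgType laurent).
Implicit Types (S : qseed m n F) (i j : 'I_m) (e : 'cV[int]_m).

Lemma basis_vecE i j : basis_vec i j 0 = (j == i)%:Z.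
Proof. by rewrite mxE andbT natz. Qed.

Lemma qmon_pair S i j : (i < j)%N ->
  qmon S (basis_vec i + basis_vec j) =
  qhalf (- qform S i j) *: (cluster S i * cluster S j).
Proof.
move=> lt_ij; have nij : i != j by rewrite neq_ltn lt_ij.
have e0 l : l != i -> l != j -> (basis_vec i + basis_vec j) l 0 = 0.
  by move=> nli nlj; rewrite mxE !basis_vecE (negPf nli) (negPf nlj).
have ei : (basis_vec i + basis_vec j) i 0 = 1.
  by rewrite mxE !basis_vecE eqxx (negPf nij).
have ej : (basis_vec i + basis_vec j) j 0 = 1.
  by rewrite mxE !basis_vecE eqxx [j == i]eq_sym (negPf nij).
rewrite /qmon; congr (qhalf (- _) *: _); last first.
  rewrite (big_ord_pair _ lt_ij) ?ei ?ej ?expr1z // => l nli nlj.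
  by rewrite e0 // expr0z.
rewrite (bigD1 i) //= [X in _ + X]big1 ?addr0.
  rewrite (bigD1 j) //= [X in _ + X]big1 ?addr0 ?ei ?ej ?mulr1 //.
  by move=> l /andP[il nlj]; rewrite e0 ?mulr0 // neq_ltn il orbT.
move=> l nli; rewrite big1 // => l' ll'.
case: (eqVneq l j) => [lj|nlj]; last by rewrite e0 // mulr0 mul0r.
have lt_jl' : (j < l')%N by rewrite -lj.
by rewrite (e0 l') ?mulr0 // neq_ltn ?lt_jl' ?(ltn_trans lt_ij lt_jl') orbT.
Qed.

Lemma qmon_double S i : qmon S (basis_vec i + basis_vec i) = cluster S i ^+ 2.
Proof.
have e0 l : l != i -> (basis_vec i + basis_vec i) l 0 = 0.
  by move=> nli; rewrite mxE !basis_vecE (negPf nli).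
rewrite /qmon big1 => [|l _].
  rewrite oppr0 qhalf0 scale1r.
  transitivity (\prod_(l | l == i) cluster S l ^+ 2);
    last by rewrite big_pred1_eq.
  rewrite [RHS]big_mkcond; apply: eq_bigr => l _; case: eqVneq => [->|nli].
    by rewrite mxE !basis_vecE eqxx.
  by rewrite e0 // expr0z.
rewrite big1 // => l' ll'; case: (eqVneq l i) => [li|nli].
  by rewrite (e0 l') ?mulr0 // neq_ltn -li ll' orbT.
by rewrite e0 // mulr0 mul0r.
Qed.

(** The changed variable and the changed entries of the form occur only with exponent zero. *)
Lemma qmon_mutation_fixed S (k : 'I_n) e : e (widen_ord le_nm k) 0 = 0 ->
  qmon (mutation le_nm k S) e = qmon S e.
Proof.
move=> ek; rewrite /qmon; congr (qhalf (- _) *: _).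
  apply: eq_bigr => i _; apply: eq_bigr => j _ /=; rewrite mxE.
  case: eqVneq => [->|nik]; first by rewrite ek !mulr0 !mul0r.
  by case: eqVneq => [->|nij] //; rewrite ek !mulr0.
apply: eq_bigr => i _ /=; rewrite /mut_cluster.
by case: eqVneq => [->|//]; rewrite ek !expr0z.
Qed.

End Seeds.

Lemma scale_qhalf_unit (F : unitAlgType laurent) a (y : F) :
  y \is a GRing.unit -> qhalf a *: y \is a GRing.unit.
Proof.
move=> Uy; apply/unitrP; exists (qhalf (- a) *: y^-1).
rewrite -!scalerAl -!scalerAr !scalerA -!qhalfD addNr subrr qhalf0 !scale1r.
by rewrite divrr ?mulVr.
Qed.

(** * Quantum torus monomials inside [F] *)

Section TorusMonomials.
Context (m : nat) (Lam : 'M[int]_m) (F : unitAlgType laurent).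
Context (iota : {lrmorphism qtorus Lam -> F}).
Implicit Types (e f g : 'cV[int]_m).

Definition tmon e : F := iota (torus_mon Lam e).

Lemma tmon0 : tmon 0 = 1.
Proof. exact: rmorph1. Qed.

Lemma tmonM e f : tmon e * tmon f = qhalf (lam_form Lam e f) *: tmon (e + f).
Proof. rewrite /tmon -rmorphM torus_monM; exact: linearZ. Qed.

Lemma scale_tmon (a : laurent) e :
  a *: tmon e = iota (<< a *g e >> : {malg laurent['cV[int]_m]}).
Proof.
transitivity (iota (a *: torus_mon Lam e)); first by symmetry; exact: linearZ.
by congr (iota _); rewrite [LHS]twscaleU mulr1.
Qed.

Lemma tmon_free (inj_iota : injective iota) e f g (a b : laurent) :
  a *: tmon e = b *: tmon f -> a *+ (e == g) = b *+ (f == g).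
Proof.
rewrite !scale_tmon => /inj_iota eq_ab.
have := congr1 (fun x : {malg laurent['cV[int]_m]} => mcoeff g x) eq_ab.
by rewrite !mcoeffU.
Qed.

(** The normalizing scalar of [qmon] is the inverse of the one produced by [mon_prod]. *)
Lemma qmon_initial n (B : 'M[int]_(m, n)) (skewLam : Lam^T = - Lam) e :
  qmon (initial_seed B iota) e = tmon e.
Proof.
rewrite /qmon /initial_seed /=.
under [X in _ *: X]eq_bigr do
  rewrite -/(tmon _) (mon_exprz qhalf0 skewLam tmon0 tmonM).
rewrite (mon_prod qhalf0 qhalfD tmon0 tmonM) scalerA -qhalfD -col_basis_sum.
rewrite [X in qhalf X](_ : _ = 0) ?qhalf0 ?scale1r //.
apply/eqP; rewrite addrC subr_eq0; apply/eqP; apply: eq_bigr => i _.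
by apply: eq_bigr => j _; rewrite lam_formZZ lam_form_delta; ring.
Qed.

End TorusMonomials.

(** * Monomials of the mutated seed *)

Section Mutation.
Context (m n : nat) (le_nm : (n <= m)%N) (B : 'M[int]_(m, n)) (Lam : 'M[int]_m).
Context (skewLam : Lam^T = - Lam) (k : 'I_n).
Let k' : 'I_m := widen_ord le_nm k.
Let b := col k B.
Context (lam_col : forall j, j != k' -> lam_form Lam (basis_vec j) b = 0).
Context (F : unitAlgType laurent) (iota : {lrmorphism qtorus Lam -> F}).
Let S0 := initial_seed B iota.
Let S := mutation le_nm k S0.
Let up := - basis_vec k' + map_mx posp b.
Let un := - basis_vec k' + map_mx posp (- b).

Lemma cluster_mutation :
  cluster S k' = tmon iota up + tmon iota un.
Proof. by rewrite /= /mut_cluster eqxx !qmon_initial. Qed.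

Lemma cluster_mutation_fixed j :
  j != k' -> cluster S j = tmon iota (basis_vec j).
Proof. by move=> njk; rewrite /= /mut_cluster (negPf njk). Qed.

Lemma qform_mutationl j : j != k' -> qform S k' j = mut_row le_nm k S0 j.
Proof. by move=> njk; rewrite [LHS]mxE eqxx (negPf njk). Qed.

Lemma qform_mutationr j : j != k' -> qform S j k' = - mut_row le_nm k S0 j.
Proof. by move=> njk; rewrite [LHS]mxE eqxx (negPf njk). Qed.

(** By skewness this is the form of [up] with [basis_vec j]: the new row of the form records how the
    monomial with exponent [up] commutes with the old variables. *)
Lemma mut_row_form j : mut_row le_nm k S0 j = - lam_form Lam (basis_vec j) up.
Proof.
rewrite /mut_row lam_formDr lam_formNr lam_form_delta lam_form_basisl /=.
rewrite opprD opprK (skew_entry skewLam k' j) opprK; congr (_ + _).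
rewrite -sumrN; apply: eq_bigr => l _; rewrite !mxE (skew_entry skewLam l j).
by rewrite mulrN mulrC.
Qed.

Lemma lam_form_up_un j : j != k' ->
  lam_form Lam (basis_vec j) up = lam_form Lam (basis_vec j) un.
Proof.
by move=> njk; rewrite /up /un !lam_formDr map_pospN lam_formDr lam_col ?addr0.
Qed.

Lemma qmon_mutation_pair j : j != k' ->
  qmon S (basis_vec k' + basis_vec j) =
  qhalf (- mut_row le_nm k S0 j) *: (cluster S k' * tmon iota (basis_vec j)).
Proof.
move=> njk; have := njk; rewrite neq_ltn => /orP[lt_jk|lt_kj]; last first.
  rewrite (qmon_pair _ lt_kj) qform_mutationl //.
  by rewrite (cluster_mutation_fixed njk).
rewrite addrC (qmon_pair _ lt_jk) qform_mutationr //.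
rewrite (cluster_mutation_fixed njk).
rewrite opprK cluster_mutation.
(* For [j < k] the new variable stands on the right. Moving it to the left adds [- 2] times
   [mut_row] to the exponent, which reverses its sign. *)
have binom :=
  mon_binomial_comm qhalfD skewLam (tmonM iota) (lam_form_up_un njk).
apply: etrans (congr1 (GRing.scale (qhalf (mut_row le_nm k S0 j))) binom) _.
rewrite scalerA -qhalfD mut_row_form opprK.
by congr (qhalf _ *: _); ring.
Qed.

End Mutation.

Lemma qmon_pair_unit m n (F : unitAlgType laurent) (S : qseed m n F) i j :
  (forall l, cluster S l \is a GRing.unit) ->
  qmon S (basis_vec i + basis_vec j) \is a GRing.unit.
Proof.
move=> US; have [lt_ij|lt_ji|/val_inj <-] := ltngtP i j.
- by rewrite (qmon_pair _ lt_ij) scale_qhalf_unit ?unitrMl ?US.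
- by rewrite addrC (qmon_pair _ lt_ji) scale_qhalf_unit ?unitrMl ?US.
- by rewrite qmon_double unitrX ?US.
Qed.

(* The additive and multiplicative structures of [val] are inferred separately;
   this declares their join. *)
HB.instance Definition _ m n (le_nm : (n <= m)%N) (F : unitAlgType laurent)
    (S0 : qseed m n F) :=
  GRing.RMorphism.on (val : cluster_algebra le_nm S0 -> F).

(** * Skewness of Poisson matrices *)

Section PoissonMatrix.
Context (m n : nat) (le_nm : (n <= m)%N) (F : unitAlgType laurent).
Context (scale_inj : forall (y : F) (a b : laurent),
  y \is a GRing.unit -> a *: y = b *: y -> a = b).
Context (S0 S : qseed m n F) (eqS : mutation_equivalent le_nm S0 S).
Context (unitS : forall l, cluster S l \is a GRing.unit).
Context (br : cluster_algebra le_nm S0 -> cluster_algebra le_nm S0 ->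
  cluster_algebra le_nm S0) (poisson_br : is_poisson br).
Context (Om : 'M[laurent]_m) (logOm : log_canonical eqS br Om).

Lemma poisson_matrix_skew i j : Om i j = - Om j i.
Proof.
apply: (scale_inj (qmon_pair_unit i j unitS)).
rewrite scaleNr; apply: etrans (esym (logOm i j)) _; rewrite poisson_anti //.
rewrite [val _]raddfN; congr (- _); apply: etrans (logOm j i) _.
by rewrite addrC.
Qed.

Lemma poisson_matrix_diag i : Om i i = 0.
Proof.
apply: (scale_inj (qmon_pair_unit i i unitS)); rewrite scale0r.
apply: etrans (esym (logOm i i)) _; rewrite (poisson_alt poisson_br).
exact: raddf0.
Qed.

End PoissonMatrix.

(** * Consequences of compatibility *)

Section Compatible.
Context (m n : nat) (le_nm : (n <= m)%N) (B : 'M[int]_(m, n)) (Lam : 'M[int]_m).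
Context (d : 'rV[int]_n) (compatBLam : compatible_pair le_nm B Lam d) (k : 'I_n).

Lemma compatible_lam_form j :
  lam_form Lam (basis_vec j) (col k B) = - (d 0 k *+ (k == j :> nat)).
Proof.
have [_ _ skewLam BLam] := compatBLam.
have /matrixP/(_ k j) := BLam; rewrite !mxE => <-.
rewrite lam_form_basisl -sumrN; apply: eq_bigr => l _.
by rewrite !mxE (skew_entry skewLam j l) mulNr mulrC.
Qed.

(** A zero column would force the positive entry [d 0 k] to vanish. *)
Lemma compatible_col_neq0 : col k B != 0.
Proof.
have [d_gt0 _ _ _] := compatBLam; apply/eqP => B0.
have := compatible_lam_form (widen_ord le_nm k).
rewrite B0 lam_form0r eqxx mulr1n => /esym/eqP.
by rewrite oppr_eq0 (negPf (lt0r_neq0 (d_gt0 k))).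
Qed.

Lemma compatible_diag0 : B (widen_ord le_nm k) k = 0.
Proof.
have [d_gt0 skewDB _ _] := compatBLam.
have /matrixP/(_ k k) := skewDB; rewrite mul_diag_mx !mxE => /eqP.
rewrite -addr_eq0 -mulr2n mulrn_eq0 mulf_eq0 (negPf (lt0r_neq0 (d_gt0 k))) /=.
by move/eqP.
Qed.

End Compatible.

(** * The exchange identity and the mutated Poisson matrix *)

Theorem theorem2p1 (m n : nat) (le_nm : (n <= m)%N)
    (B : 'M[int]_(m, n)) (Lam : 'M[int]_m) (d : 'rV[int]_n)
    (compatBLam : compatible_pair le_nm B Lam d)
    (F : unitAlgType laurent) (iota : {lrmorphism qtorus Lam -> F})
    (fracF : is_skew_fraction_field iota)
    (k : 'I_n)
    (br : cluster_algebra le_nm (initial_seed B iota) ->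
          cluster_algebra le_nm (initial_seed B iota) ->
          cluster_algebra le_nm (initial_seed B iota))
    (poisson_br : is_poisson br)
    (br_nontrivial : exists x y, br x y <> 0)
    (Om Om' : 'M[laurent]_m)
    (logOm : log_canonical (mutation_refl le_nm (initial_seed B iota)) br Om)
    (logOm' : log_canonical
       (mutation_step k (mutation_refl le_nm (initial_seed B iota))) br Om') :
  let k' : 'I_m := widen_ord le_nm k in
  let L := exchange_side (col k B) Lam Om k' in
  let R := exchange_side (- col k B) Lam Om k' in
  (forall j : 'I_m, j != k' -> L j = R j) /\
  (forall H : 'I_m -> laurent,
     (forall j, j != k' -> H j = L j /\ H j = R j) ->
     forall i j : 'I_m,
       Om' i j =
         if (i == k') && (j != k') then
           qhalf (Lam j k' - \sum_(t < m) posp (B t k) * Lam j t) * H j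
         else if (j == k') && (i != k') then - Om' k' i
         else Om i j).
Proof.
move=> k' L R.
have [inj_iota unitF _] := fracF.
have [_ _ skewLam _] := compatBLam.
have b0 : col k B k' 0 = 0 by rewrite mxE (compatible_diag0 compatBLam).
have bn0 := compatible_col_neq0 compatBLam k.
have lam_col j : j != k' -> lam_form Lam (basis_vec j) (col k B) = 0.
  move=> njk; rewrite (compatible_lam_form compatBLam).
  by rewrite (negPf (_ : (k : nat) != j)) ?oppr0 // eq_sym.
pose S0 := initial_seed B iota; pose S := mutation le_nm k S0.
pose x := cluster_elt (mutation_refl le_nm S0).
pose y := cluster_elt (mutation_step k (mutation_refl le_nm S0)).
have yx j : j != k' -> y j = x j.
  by move=> njk; apply: val_inj; rewrite /= /mut_cluster (negPf njk).
have val_yk : val (y k') = tmon iota _ + tmon iota _ :=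
  cluster_mutation le_nm B skewLam k iota.
have vx i : val (x i) = tmon iota (basis_vec i) by [].
have logx i j :
    val (br (x i) (x j)) = Om i j *: tmon iota (basis_vec i + basis_vec j).
  by rewrite -(qmon_initial iota B skewLam); apply: logOm.
pose row := mut_row le_nm k S0.
have brk j : j != k' -> val (br (y k') (x j)) =
    (Om' k' j * qhalf (- row j)) *: (val (y k') * tmon iota (basis_vec j)).
  move=> njk; rewrite -(yx j njk) -scalerA; apply: etrans (logOm' k' j) _.
  by congr (_ *: _); apply: (qmon_mutation_pair skewLam lam_col iota njk).
pose v := [the {lrmorphism cluster_algebra le_nm S0 -> F} of
  (val : cluster_algebra le_nm S0 -> F)].
have inj_v : injective v := val_inj.
(* Both sides equal the scalar that multiplies [X_k' X_j] in the bracket; the factor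
   [qhalf (- row j)] comes from normalizing this product. *)
have main j (njk : j != k') : L j = Om' k' j * qhalf (- row j)
    /\ R j = Om' k' j * qhalf (- row j) :=
  exchange_sum_mutation qhalf0 qhalfD skewLam (tmon0 iota) (tmonM iota)
    (tmon_free inj_iota) inj_v poisson_br vx logx b0 bn0 val_yk
    (lam_col j njk) (brk j njk).
split=> [j njk|H HL i j]; first by have [-> ->] := main j njk.
have scale_inj := scale_unit_inj (tmon0 iota) (tmon_free inj_iota).
have unit_mon e : tmon iota e \is a GRing.unit.
  exact: (mon_unit qhalf0 skewLam (tmon0 iota) (tmonM iota)).
have unitS l : cluster S l \is a GRing.unit.
  have [->|nlk] := eqVneq l k';
    last by rewrite (cluster_mutation_fixed _ _ nlk).
  apply: unitF; rewrite (cluster_mutation le_nm B skewLam).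
  have neq_exp := exchange_exponents_neq k' bn0.
  exact: (mon_binomial_neq0 (tmon_free inj_iota) neq_exp).
have unitS0 l : cluster S0 l \is a GRing.unit by apply: unit_mon.
have skewOm' := poisson_matrix_skew scale_inj unitS poisson_br logOm'.
have [->|nik] := eqVneq i k'; have [->|njk] := eqVneq j k' => /=.
(* At [i = j = k'] the last branch of the formula applies, and both diagonal entries are zero. *)
- rewrite (poisson_matrix_diag scale_inj unitS poisson_br logOm').
  by rewrite (poisson_matrix_diag scale_inj unitS0 poisson_br logOm).
- have [-> _] := HL j njk; have [-> _] := main j njk.
  (* The exponent in the formula is [row j], which cancels the normalization. *)
  rewrite mulrCA -qhalfD [X in qhalf X](_ : _ = 0) ?qhalf0 ?mulr1 //.
  rewrite /row /mut_row /= (skew_entry skewLam k' j) opprK.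
  apply/eqP; rewrite subr_eq0; apply/eqP; congr (_ + _); rewrite -sumrN.
  by apply: eq_bigr => t _; rewrite (skew_entry skewLam t j) mulrN.
- exact: skewOm'.
(* Away from [k'] both seeds share the two variables and their normalized product, so one bracket
   determines both entries. *)
apply: (scale_inj _ _ _ (qmon_pair_unit i j unitS)).
apply: etrans (esym (logOm' i j)) _.
rewrite -/S0 -/(y i) -/(y j) !yx // logx -(qmon_initial iota B skewLam).
congr (_ *: _); rewrite -/S0.
rewrite -(qmon_mutation_fixed (le_nm := le_nm) S0 (k := k)) //.
by rewrite mxE !basis_vecE ![k' == _]eq_sym (negPf nik) (negPf njk).
Qed.
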